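(* Let $R$ and $H$ be two Leibniz conformal algebras, let $\mathcal E:0\to H\xrightarrow{\alpha}E\xrightarrow{p}R\to0$ be a non-abelian extension of $R$ by $H$ with a section $s$, and let $(l,r,\chi)$ be the corresponding non-abelian $2$-cocycle. Then a pair $(\gamma,\varphi)\in\mathrm{Aut}(H)\times\mathrm{Aut}(R)$ is inducible if and only if the non-abelian $2$-cocycles $(l,r,\chi)$ and $(l^{\gamma,\varphi},r^{\gamma,\varphi},\chi^{\gamma,\varphi})$ are equivalent.
   Context: All vector spaces are over $\mathbb C$ and all $\mathbb C[\partial]$-modules are finitely generated. A Leibniz conformal algebra is a $\mathbb C[\partial]$-module $R$ with a $\mathbb C$-bilinear $\lambda$-bracket $R\times R\to R[\lambda]$, $(a,b)\mapsto[a_\lambda b]$, such that $[(\partial a)_\lambda b]=-\lambda[a_\lambda b]$, $[a_\lambda\partial b]=(\partial+\lambda)[a_\lambda b]$ and $[a_\lambda[b_\mu c]]=[[a_\lambda b]_{\lambda+\mu}c]+[b_\mu[a_\lambda c]]$. Homomorphisms are $\mathbb C[\partial]$-linear maps preserving $\lambda$-brackets; $\mathrm{Aut}(\cdot)$ is the group of bijective endomorphisms. Brackets and maps are extended linearly to polynomials in the formal variables; for $x(\lambda)=\sum_k\lambda^kx_k$, $x(-\partial-\mu)$ means $\sum_k(-\partial-\mu)^kx_k$. A (non-abelian) extension of $R$ by $H$ is a short exact sequence $0\to H\xrightarrow{\alpha}E\xrightarrow{p}R\to0$ of Leibniz conformal algebras and homomorphisms ($H$ is identified with $\alpha(H)\subseteq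 E$); a section is a $\mathbb C[\partial]$-module homomorphism $s:R\to E$ with $p\circ s=\mathrm{id}_R$. The corresponding non-abelian $2$-cocycle $(l,r,\chi)$ is $l(a)_\lambda(h)=[s(a)_\lambda h]$, $r(a)_\lambda(h)=[h_{-\partial-\lambda}s(a)]$, $\chi_\lambda(a,b)=[s(a)_\lambda s(b)]-s([a_\lambda b])$. For $(\gamma,\varphi)\in\mathrm{Aut}(H)\times\mathrm{Aut}(R)$ put $l^{\gamma,\varphi}(a)_\lambda(h)=\gamma(l(\varphi^{-1}(a))_\lambda\gamma^{-1}(h))$, $r^{\gamma,\varphi}(a)_\lambda(h)=\gamma(r(\varphi^{-1}(a))_\lambda\gamma^{-1}(h))$, $\chi^{\gamma,\varphi}_\lambda(a,b)=\gamma(\chi_\lambda(\varphi^{-1}(a),\varphi^{-1}(b)))$; this is again a non-abelian $2$-cocycle. Two non-abelian $2$-cocycles $(l,r,\chi)$, $(l',r',\chi')$ are equivalent if there is a $\mathbb C[\partial]$-module homomorphism $\beta:R\to H$ such that for all $a,b\in R$, $h\in H$: $l'(a)_\lambda h-l(a)_\lambda h=[\beta(a)_\lambda h]$, $r'(a)_\lambda h-r(a)_\lambda h=[h_{-\partial-\lambda}\beta(a)]$ and $\chi'_\lambda(a,b)=\chi_\lambda(a,b)+l(a)_\lambda\beta(b)+r(b)_{-\partial-\lambda}\beta(a)-\beta([a_\lambda b])+[\beta(a)_\lambda\beta(b)]$. (This is an equivalence relation.) $\mathrm{Aut}_H(E)=\{f\in\mathrm{Aut}(E)\mid f(H)=H\}$.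 For $f\in\mathrm{Aut}_H(E)$, $\hat f=p\circ f\circ s\in\mathrm{Aut}(R)$, independent of $s$. The pair $(\gamma,\varphi)$ is inducible if there is $f\in\mathrm{Aut}_H(E)$ with $(\gamma,\varphi)=(f|_H,\hat f)$. *)

(* Defs.v *)
From HB Require Import structures.
From mathcomp Require Import all_boot all_order all_algebra finmap.
From mathcomp.multinomials Require Import monalg.
From mathcomp Require Import complex reals.

Set Implicit Arguments.
Unset Strict Implicit.
Unset Printing Implicit Defensive.

Import GRing.Theory.
Local Open Scope ring_scope.

(* M[X]: polynomials in one formal variable with coefficients in a left
   K-module M.  {malg M[nat]} is the additive group of finitely supported
   families x = (x_k), and x@_k is the coefficient of X^k; it is made a left
   module over K[X] = {poly K}.  The construction iterates: M[X][Y] is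
   polymod (polymod M), a left module over K[X][Y]. *)
Definition polymod (K : nzRingType) (M : lmodType K) := {malg M[nat]}.

HB.instance Definition _ (K : nzRingType) (M : lmodType K) :=
  GRing.Zmodule.copy (polymod M) {malg M[nat]}.

Section PolymodModule.
Variables (K : nzRingType) (M : lmodType K).
Implicit Types (p q : {poly K}) (x y : polymod M).

Definition polymod_scale p x : polymod M :=
  \sum_(k <- msupp x) \sum_(i < size p) << p`_i *: x@_k *g (i + k)%N >>.

Lemma mcoeff_polymod_scale p x n :
  (polymod_scale p x)@_n = \sum_(i < n.+1) p`_i *: x@_(n - i)%N.
Proof.
rewrite /polymod_scale exchange_big raddf_sum /=.
have E i : (\sum_(k <- msupp x) << p`_i *: x@_k *g (i + k)%N >>)@_n
           = if (i <= n)%N then p`_i *: x@_(n - i)%N else 0.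
  rewrite raddf_sum /=.
  under eq_bigr => k _ do rewrite mcoeffU.
  case: leqP => [le_in | lt_ni]; last first.
    rewrite big1 // => k _; case: eqP => // e.
    by move: lt_ni; rewrite -e ltnNge leq_addr.
  have [nx | nx] := boolP ((n - i)%N \in msupp x).
    rewrite (bigD1_seq (n - i)%N) ?fset_uniq //= subnKC // eqxx mulr1n.
    rewrite big1 ?addr0 // => k /negPf nk; case: eqP => // e.
    by rewrite -e addKn eqxx in nk.
  rewrite mcoeff_outdom // scaler0 big_seq big1 // => k kx.
  case: eqP => // e; by rewrite -e addKn kx in nx.
under eq_bigr => i _ do rewrite E.
rewrite -(big_mkord xpredT
  (fun i => if (i <= n)%N then p`_i *: x@_(n - i)%N else 0)).
rewrite -(big_mkord xpredT (fun i => p`_i *: x@_(n - i)%N)).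
have W m F : (size p <= m)%N -> (forall i, (size p <= i)%N -> F i = 0) ->
    \sum_(0 <= i < size p) F i = \sum_(0 <= i < m) F i :> M.
  move=> le F0; rewrite [RHS](@big_cat_nat _ _ _ (size p)) //=.
  rewrite [X in _ + X]big_nat_cond
    [X in _ + X]big1 ?addr0 //.
  by move=> i /andP[/andP[/F0]].
rewrite (W (maxn (size p) n.+1)) ?leq_maxl //; last first.
  by move=> i le; rewrite nth_default // scale0r if_same.
rewrite (@big_cat_nat _ _ _ n.+1 0 _) ?leq_maxr //=.
rewrite [X in _ + X]big_nat_cond [X in _ + X]big1 ?addr0.
  by rewrite big_nat [RHS]big_nat; apply: eq_bigr => i; rewrite ltnS /= => ->.
by move=> i /andP[/andP[]]; rewrite ltnNge => /negPf->.
Qed.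

Lemma polymod_scaleA p q x :
  polymod_scale p (polymod_scale q x) = polymod_scale (p * q) x.
Proof.
apply/malgP => n; rewrite !mcoeff_polymod_scale.
under eq_bigr => i _ do rewrite mcoeff_polymod_scale scaler_sumr.
transitivity (\sum_(i < n.+1) \sum_(j < n.+1 | (i <= j)%N)
     (p`_i * q`_(j - i)%N) *: x@_(n - j)%N).
  apply: eq_bigr => i _; rewrite -(big_mkord xpredT
    (fun j => p`_i *: (q`_j *: x@_(n - i - j)%N))).
  rewrite -(big_mkord (fun j => i <= j)%N
    (fun j => (p`_i * q`_(j - i)%N) *: x@_(n - j)%N)).
  have le : (i <= n.+1)%N by rewrite ltnW.
  rewrite [RHS](@big_cat_nat _ _ _ (i : nat)) //= [X in X + _]big_nat_cond
    [X in X + _]big1 ?add0r; last first.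
    by move=> j /andP[/andP[_ ]]; rewrite ltnNge => /negPf->.
  have := big_addn 0 n.+1 i (fun j => i <= j)%N
    (fun j => (p`_i * q`_(j - i)%N) *: x@_(n - j)%N).
  rewrite add0n => ->; rewrite subSn; last by rewrite -ltnS.
  apply: eq_big => [j|j _]; first by rewrite leq_addl.
  by rewrite scalerA addnK addnC subnDA.
rewrite (exchange_big_dep xpredT) //=; apply: eq_bigr => j _.
rewrite coefM scaler_suml.
rewrite -(big_mkord (fun i => i <= j)%N
  (fun i => (p`_i * q`_(j - i)%N) *: x@_(n - j)%N)).
rewrite -(big_mkord xpredT
  (fun i => (p`_i * q`_(j - i)%N) *: x@_(n - j)%N)).
rewrite (@big_cat_nat _ _ _ j.+1) //= [X in _ + X]big_nat_cond.
rewrite [X in _ + X]big1 ?addr0; last first.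
  by move=> i /andP[/andP[]]; rewrite ltnNge => /negPf->.
rewrite big_nat_cond [RHS]big_nat_cond; apply: eq_bigl => i.
by rewrite ltnS andbT /=; case: leqP.
Qed.

Lemma polymod_scale1 x : polymod_scale 1 x = x.
Proof.
apply/malgP => n; rewrite mcoeff_polymod_scale big_ord_recl coef1 scale1r subn0.
by rewrite big1 ?addr0 // => i _; rewrite coef1 scale0r.
Qed.

Lemma polymod_scaleDr p x y :
  polymod_scale p (x + y) = polymod_scale p x + polymod_scale p y.
Proof.
apply/malgP => n; rewrite mcoeffD !mcoeff_polymod_scale -big_split /=.
by apply: eq_bigr => i _; rewrite mcoeffD scalerDr.
Qed.

Lemma polymod_scaleDl x p q :
  polymod_scale (p + q) x = polymod_scale p x + polymod_scale q x.
Proof.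
apply/malgP => n; rewrite mcoeffD !mcoeff_polymod_scale -big_split /=.
by apply: eq_bigr => i _; rewrite coefD scalerDl.
Qed.

HB.instance Definition _ :=
  GRing.Zmodule_isLmodule.Build {poly K} (polymod M)
    polymod_scaleA polymod_scale1 polymod_scaleDr polymod_scaleDl.

Definition polymod_const (m : M) : polymod M := << m *g 0%N >>.

(* For x = \sum_k X^k x_k, the element \sum_k t^k f(x_k): apply f to the
   coefficients and put t in place of the variable. *)
Definition polymod_eval (L : nzRingType) (N : lmodType L) (f : M -> N) (t : L)
  (x : polymod M) : N := \sum_(k <- msupp x) t ^+ k *: f x@_k.

End PolymodModule.

Definition polymod_map (K : nzRingType) (M N : lmodType K) (f : M -> N) :
  polymod M -> polymod N := polymod_eval (fun m => polymod_const (f m)) 'X.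

Definition finitely_generated (K : nzRingType) (M : lmodType K) : Prop :=
  exists (n : nat) (g : 'I_n -> M),
    forall x : M, exists c : 'I_n -> K, x = \sum_i c i *: g i.

(* A C[d]-module is a left {poly C}-module; d acts as 'X and a scalar c as
   c%:P.  The target M[lambda] of a lambda-bracket is a module over
   {poly {poly C}} = C[d][lambda], in which d is 'X%:P and lambda is 'X. *)
Section Bracket.
Variables (C : fieldType) (M : lmodType {poly C}).

Definition d_var : {poly {poly C}} := 'X%:P.
Definition lambda_var : {poly {poly C}} := 'X.

(* x(lambda) |-> x(- d - lambda) *)
Definition polymod_flip (x : polymod M) : polymod M :=
  polymod_eval (@polymod_const _ M) (- d_var - lambda_var) x.

Variable br : M -> M -> polymod M.

Definition C_bilinear : Prop :=
  (forall (c : C) (a a' b : M),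
     br (c%:P *: a + a') b = c%:P%:P *: br a b + br a' b) /\
  (forall (c : C) (a b b' : M),
     br a (c%:P *: b + b') = c%:P%:P *: br a b + br a b').

Definition sesquilinear_left : Prop :=
  forall a b : M, br ('X *: a) b = - (lambda_var *: br a b).

Definition sesquilinear_right : Prop :=
  forall a b : M, br a ('X *: b) = (d_var + lambda_var) *: br a b.

(* An identity in M[lambda][mu], a module over C[d][lambda][mu]. *)
Definition leibniz_identity : Prop :=
  let lambda : {poly {poly {poly C}}} := 'X%:P in
  let mu : {poly {poly {poly C}}} := 'X in
  let br_at (t : {poly {poly {poly C}}}) (a b : M) : polymod (polymod M) :=
    polymod_eval (fun m => polymod_const (polymod_const m)) t (br a b) in
  forall a b c : M,
    polymod_eval (fun x => br_at lambda a x) mu (br b c)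
    = polymod_eval (fun x => br_at (lambda + mu) x c) lambda (br a b)
      + polymod_eval (fun x => br_at mu b x) lambda (br a c).

End Bracket.

HB.mixin Record isLeibnizConformal (C : fieldType) A
    of GRing.Lmodule {poly C} A := {
  lbr : A -> A -> polymod A;
  lbr_bilinear : C_bilinear lbr;
  lbr_dl : sesquilinear_left lbr;
  lbr_dr : sesquilinear_right lbr;
  lbr_leibniz : leibniz_identity lbr;
  lca_fg : finitely_generated A
}.

#[short(type="leibnizConformalType")]
HB.structure Definition LeibnizConformal (C : fieldType) :=
  {A of GRing.Lmodule {poly C} A & isLeibnizConformal C A}.

Definition lca_morphism (C : fieldType) (A B : leibnizConformalType C)
    (f : A -> B) : Prop :=
  forall a b : A, polymod_map f (lbr a b) = lbr (f a) (f b).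

Record lcaAut (C : fieldType) (A : leibnizConformalType C) := LcaAut {
  aut_fun :> {linear A -> A};
  aut_morphism : lca_morphism aut_fun;
  aut_bij : bijective aut_fun
}.

Lemma aut_surj (C : fieldType) (A : leibnizConformalType C) (f : lcaAut A)
  (y : A) : exists x, f x == y.
Proof. by case: (aut_bij f) => g _ gK; exists (g y); rewrite gK. Qed.

Definition aut_inv (C : fieldType) (A : leibnizConformalType C) (f : lcaAut A)
  (y : A) : A := xchoose (aut_surj f y).

Lemma aut_invK (C : fieldType) (A : leibnizConformalType C) (f : lcaAut A) :
  cancel (aut_inv f) f.
Proof. by move=> y; apply/eqP; exact: (xchooseP (aut_surj f y)). Qed.

Record extension (C : fieldType) (H E R : leibnizConformalType C) := Extension {
  ext_inj : {linear H -> E};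
  ext_proj : {linear E -> R};
  ext_inj_morphism : lca_morphism ext_inj;
  ext_proj_morphism : lca_morphism ext_proj;
  ext_injective : injective ext_inj;
  ext_exact : forall x : E, ext_proj x = 0 <-> exists h : H, x = ext_inj h;
  ext_surjective : forall a : R, exists x : E, ext_proj x = a
}.

Definition is_section (C : fieldType) (H E R : leibnizConformalType C)
    (X : extension H E R) (s : {linear R -> E}) : Prop :=
  forall a : R, ext_proj X (s a) = a.

(* coc_l c a h is l(a)_lambda(h), coc_r c a h is r(a)_lambda(h), and
   coc_chi c a b is chi_lambda(a, b). *)
Record cocycle_data (C : fieldType) (H R : leibnizConformalType C) :=
  CocycleData {
    coc_l : R -> H -> polymod H;
    coc_r : R -> H -> polymod H;
    coc_chi : R -> R -> polymod H
  }.

(* The defining formulas hold in E[lambda], H[lambda] being embedded by alpha;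
   as alpha is injective, they determine c. *)
Definition is_cocycle_of (C : fieldType) (H E R : leibnizConformalType C)
    (X : extension H E R) (s : {linear R -> E}) (c : cocycle_data H R) : Prop :=
  let alpha := ext_inj X in
  [/\ forall (a : R) (h : H),
        polymod_map alpha (coc_l c a h) = lbr (s a) (alpha h),
      forall (a : R) (h : H),
        polymod_map alpha (coc_r c a h) = polymod_flip (lbr (alpha h) (s a))
    & forall a b : R,
        polymod_map alpha (coc_chi c a b)
        = lbr (s a) (s b) - polymod_map s (lbr a b)].

Definition twist (C : fieldType) (H R : leibnizConformalType C)
    (g : lcaAut H) (f : lcaAut R) (c : cocycle_data H R) : cocycle_data H R :=
  {| coc_l := fun a h => polymod_map g (coc_l c (aut_inv f a) (aut_inv g h));
     coc_r := fun a h => polymod_map g (coc_r c (aut_inv f a) (aut_inv g h));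
     coc_chi := fun a b =>
       polymod_map g (coc_chi c (aut_inv f a) (aut_inv f b)) |}.

Definition cocycle_equivalent (C : fieldType) (H R : leibnizConformalType C)
    (c c' : cocycle_data H R) : Prop :=
  exists beta : {linear R -> H},
  [/\ forall (a : R) (h : H),
        coc_l c' a h - coc_l c a h = lbr (beta a) h,
      forall (a : R) (h : H),
        coc_r c' a h - coc_r c a h = polymod_flip (lbr h (beta a))
    & forall a b : R,
        coc_chi c' a b
        = coc_chi c a b + coc_l c a (beta b) + polymod_flip (coc_r c b (beta a))
          - polymod_map beta (lbr a b) + lbr (beta a) (beta b)].

(* f(H) = H, with H identified with the image of alpha *)
Definition preserves_kernel (C : fieldType) (H E R : leibnizConformalType C)
    (X : extension H E R) (f : lcaAut E) : Prop :=
  forall x : E, (exists h : H, x = f (ext_inj X h)) <->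
                (exists h : H, x = ext_inj X h).

Definition inducible (C : fieldType) (H E R : leibnizConformalType C)
    (X : extension H E R) (s : {linear R -> E})
    (gamma : lcaAut H) (phi : lcaAut R) : Prop :=
  exists f : lcaAut E,
  [/\ preserves_kernel X f,
      forall h : H, ext_inj X (gamma h) = f (ext_inj X h)
    & forall a : R, phi a = ext_proj X (f (s a))].

(* Main.v *)
(* Write E = s(R) + alpha(H).  An automorphism f of E over (gamma, phi) is
   determined by beta : R -> H with f(s(a)) = s(phi a) + alpha(beta(phi a)), and
   every C[d]-linear beta yields such a C[d]-linear bijection f.  Comparing
   f([x_lambda y]) with [f(x)_lambda f(y)] on the pairs (s(a), alpha(h)),
   (alpha(h), s(a)) and (s(a), s(b)) gives exactly the three identities
   expressing that (l, r, chi) and its twist are equivalent through beta; the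
   second pair needs that x(lambda) |-> x(- d - lambda) is an involution. *)

Require Import Defs.
From HB Require Import structures.
From mathcomp Require Import all_boot all_order all_algebra.
From mathcomp Require Import complex reals.
From mathcomp Require Import finmap.
From mathcomp.multinomials Require Import monalg.

Set Implicit Arguments.
Unset Strict Implicit.
Unset Printing Implicit Defensive.

Import GRing.Theory.
Local Open Scope ring_scope.

Section PolymodEval.
Variables (K L : nzRingType) (M : lmodType K) (N : lmodType L).
Variables (f : {additive M -> N}) (t : L).
Implicit Types x y : polymod M.

Lemma polymod_eval_widen (D : {fset nat}) x : (msupp x `<=` D)%fset ->
  polymod_eval f t x = \sum_(k <- D) t ^+ k *: f x@_k.
Proof.
move=> le; rewrite /polymod_eval; apply: big_fset_incl => // k _ nk.
by rewrite mcoeff_outdom // raddf0 scaler0.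
Qed.

Fact polymod_eval_is_zmod_morphism : zmod_morphism (polymod_eval f t).
Proof.
move=> x y; pose D := (msupp x `|` msupp y)%fset.
rewrite (@polymod_eval_widen D (x - y)) ?msuppB_le //.
rewrite (@polymod_eval_widen D x) ?fsubsetUl //.
rewrite (@polymod_eval_widen D y) ?fsubsetUr //.
rewrite -sumrB; apply: eq_bigr => k _.
by rewrite mcoeffB raddfB scalerBr.
Qed.

HB.instance Definition _ := GRing.isZmodMorphism.Build (polymod M) N
  (polymod_eval f t) polymod_eval_is_zmod_morphism.

Lemma polymod_eval_monom m k :
  polymod_eval f t (<< m *g k >> : polymod M) = t ^+ k *: f m.
Proof.
rewrite (@polymod_eval_widen [fset k]%fset) ?msuppU_le //.
by rewrite big_seq_fset1 mcoeffUU.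
Qed.

End PolymodEval.

Section PolymodMonom.
Variables (K : nzRingType) (M : lmodType K).

Fact polymod_const_is_zmod_morphism : zmod_morphism (@polymod_const K M).
Proof. by move=> x y; rewrite /polymod_const monalgUB. Qed.

HB.instance Definition _ := GRing.isZmodMorphism.Build M (polymod M)
  (@polymod_const K M) polymod_const_is_zmod_morphism.

Lemma polymod_scale_monom (c : K) (m : M) (i k : nat) :
  (c%:P * 'X^i) *: (<< m *g k >> : polymod M) = << c *: m *g (i + k)%N >>.
Proof.
apply/malgP => n; rewrite [LHS]mcoeff_polymod_scale mcoeffU.
under eq_bigr => j _ do rewrite coefCM coefXn mcoeffU.
have [<-|nk] := eqVneq (i + k)%N n.
  have lt : (i < (i + k).+1)%N by rewrite ltnS leq_addr.
  rewrite (bigD1 (Ordinal lt)) //= eqxx mulr1 addKn eqxx big1 ?addr0 //.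
  move=> j /negPf nj; have := nj; rewrite -val_eqE /= => ->.
  by rewrite mulr0 scale0r.
rewrite big1 // => j _; have [ji|] := eqVneq (j : nat) i; last first.
  by rewrite mulr0 scale0r.
case: eqP => [e|]; last by rewrite scaler0.
by rewrite e -ji subnKC ?eqxx // -ltnS in nk.
Qed.

Lemma polymod_constZ (c : K) (m : M) :
  polymod_const (c *: m) = c%:P *: polymod_const m.
Proof. by rewrite -[c%:P]mulr1 -(expr0 'X) polymod_scale_monom. Qed.

Lemma polymod_monom_ind (P : polymod M -> Prop) :
  (forall x y, P x -> P y -> P (x + y)) ->
  (forall m k, P << m *g k >>) -> forall x, P x.
Proof.
move=> PD Pm x; rewrite [x]monalgE; apply: (big_rec P) => [|k y _ Py].
  by rewrite -(monalgU0 (0%N : nat)); exact: Pm.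
exact: PD.
Qed.

End PolymodMonom.

Lemma polymod_evalZ (K : nzRingType) (L : comNzRingType) (M : lmodType K)
    (N : lmodType L) (f : {additive M -> N}) (sigma : {rmorphism K -> L})
    (t : L) (p : {poly K}) (x : polymod M) :
  (forall a m, f (a *: m) = sigma a *: f m) ->
  polymod_eval f t (p *: x) = (map_poly sigma p).[t] *: polymod_eval f t x.
Proof.
move=> fZ; elim/poly_ind: p x => [|q c IH] x.
  by rewrite rmorph0 horner0 !scale0r raddf0.
rewrite rmorphD rmorphM /= map_polyX map_polyC /= hornerMXaddC.
rewrite !scalerDl raddfD /= -!scalerA IH; congr (_ *: _ + _).
  elim/polymod_monom_ind: x => [x y IHx IHy|m k].
    by rewrite scalerDr !raddfD /= IHx IHy.
  rewrite -['X]expr1 -['X^1]mul1r polymod_scale_monom scale1r.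
  by rewrite !polymod_eval_monom add1n exprS scalerA.
elim/polymod_monom_ind: x => [x y IHx IHy|m k].
  by rewrite scalerDr !raddfD /= IHx IHy.
rewrite -[c%:P]mulr1 -(expr0 'X) polymod_scale_monom.
by rewrite !polymod_eval_monom fZ !scalerA mulrC.
Qed.

Section PolymodMap.
Variables (K : nzRingType).

Lemma mcoeff_polymod_map (M N : lmodType K) (f : {additive M -> N})
    (x : polymod M) n : (polymod_map f x)@_n = f x@_n.
Proof.
pose g := @polymod_const _ N \o f.
rewrite -[polymod_map f x]/(polymod_eval g 'X x).
rewrite (polymod_eval_widen g _ (fsubsetUl _ [fset n]%fset)) raddf_sum /=.
rewrite (bigD1_seq n) ?fset_uniq ?inE ?eqxx ?orbT //= big1 ?addr0; last first.
  move=> k /negPf nk; rewrite -['X^k]mul1r polymod_scale_monom mcoeffU addn0.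
  by rewrite nk mulr0n.
by rewrite -['X^n]mul1r polymod_scale_monom addn0 mcoeffUU scale1r.
Qed.

Fact polymod_map_is_zmod_morphism (M N : lmodType K) (f : {additive M -> N}) :
  zmod_morphism (polymod_map f).
Proof.
move=> x y; apply/malgP => n.
by rewrite mcoeffB !mcoeff_polymod_map mcoeffB raddfB.
Qed.

HB.instance Definition _ (M N : lmodType K) (f : {additive M -> N}) :=
  GRing.isZmodMorphism.Build (polymod M) (polymod N) (polymod_map f)
    (polymod_map_is_zmod_morphism f).

Lemma polymod_map_monom (M N : lmodType K) (f : {additive M -> N}) m k :
  polymod_map f << m *g k >> = << f m *g k >>.
Proof.
by apply/malgP => n; rewrite mcoeff_polymod_map !mcoeffU raddfMn.
Qed.

Lemma polymod_map_inj (M N : lmodType K) (f : {additive M -> N}) :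
  injective f -> injective (polymod_map f).
Proof.
move=> f_inj x y e; apply/malgP => n; apply: f_inj.
by rewrite -!mcoeff_polymod_map e.
Qed.

Lemma polymod_mapZ (M N : lmodType K) (f : {linear M -> N}) (p : {poly K})
    (x : polymod M) : polymod_map f (p *: x) = p *: polymod_map f x.
Proof.
apply/malgP => n; rewrite mcoeff_polymod_map [in LHS]mcoeff_polymod_scale.
rewrite [RHS]mcoeff_polymod_scale raddf_sum; apply: eq_bigr => i _.
by rewrite /= linearZ mcoeff_polymod_map.
Qed.

End PolymodMap.

Section PolymodFlip.
Variable C : fieldType.

Fact polymod_flip_is_zmod_morphism (M : lmodType {poly C}) :
  zmod_morphism (@polymod_flip C M).
Proof. exact: polymod_eval_is_zmod_morphism. Qed.

HB.instance Definition _ (M : lmodType {poly C}) :=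
  GRing.isZmodMorphism.Build (polymod M) (polymod M) (@polymod_flip C M)
    (@polymod_flip_is_zmod_morphism M).

Lemma polymod_flip_monom (M : lmodType {poly C}) (m : M) k :
  polymod_flip << m *g k >>
  = (- d_var C - lambda_var C) ^+ k *: polymod_const m.
Proof. exact: polymod_eval_monom. Qed.

Lemma polymod_flipZ (M : lmodType {poly C}) (p : {poly {poly C}})
    (x : polymod M) :
  polymod_flip (p *: x)
  = (p \Po (- d_var C - lambda_var C)) *: polymod_flip x.
Proof.
exact/polymod_evalZ/polymod_constZ.
Qed.

Lemma polymod_flipK (M : lmodType {poly C}) : involutive (@polymod_flip C M).
Proof.
elim/polymod_monom_ind => [x y IHx IHy|m k].
  by rewrite !raddfD /= IHx IHy.
have tK : (- d_var C - lambda_var C) \Po (- d_var C - lambda_var C) = 'X.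
  rewrite {1}/d_var {1}/lambda_var -polyCN comp_polyB comp_polyC comp_polyX.
  by rewrite polyCN opprD !opprK addKr.
rewrite polymod_flip_monom polymod_flipZ rmorphXn /= tK.
rewrite polymod_flip_monom expr0 scale1r -['X^k]mul1r polymod_scale_monom.
by rewrite scale1r addn0.
Qed.

Lemma polymod_map_flip (M N : lmodType {poly C}) (f : {linear M -> N})
    (x : polymod M) :
  polymod_map f (polymod_flip x) = polymod_flip (polymod_map f x).
Proof.
elim/polymod_monom_ind: x => [x y IHx IHy|m k].
  by rewrite !raddfD /= IHx IHy.
by rewrite polymod_map_monom !polymod_flip_monom polymod_mapZ polymod_map_monom.
Qed.

End PolymodFlip.

Section Bracket.
Variables (C : fieldType) (A : leibnizConformalType C).
Implicit Types a b : A.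

Lemma lbrDl a a' b : lbr (a + a') b = lbr a b + lbr a' b.
Proof.
by have [/(_ 1 a a' b) + _] := @lbr_bilinear C A; rewrite !polyC1 !scale1r.
Qed.

Lemma lbrDr a b b' : lbr a (b + b') = lbr a b + lbr a b'.
Proof.
by have [_ /(_ 1 a b b')] := @lbr_bilinear C A; rewrite !polyC1 !scale1r.
Qed.

Lemma aut_funK (f : lcaAut A) : cancel f (aut_inv f).
Proof. by move=> a; apply: (bij_inj (aut_bij f)); rewrite aut_invK. Qed.

Fact aut_inv_is_linear (f : lcaAut A) : linear (aut_inv f).
Proof.
move=> p a b; apply: (bij_inj (aut_bij f)).
by rewrite linearP !aut_invK.
Qed.

HB.instance Definition _ (f : lcaAut A) :=
  GRing.isLinear.Build {poly C} A A *:%R (aut_inv f) (aut_inv_is_linear f).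

End Bracket.

Section SplitExtension.
Variables (C : fieldType) (H E R : leibnizConformalType C).
Variables (X : extension H E R) (s : {linear R -> E}) (hs : is_section X s).
Local Notation alpha := (ext_inj X).
Local Notation p := (ext_proj X).

Lemma ext_projK h : p (alpha h) = 0.
Proof. by apply/ext_exact; exists h. Qed.

Lemma ext_retract_ex x : exists h, x - s (p x) == alpha h.
Proof.
have /ext_exact[h ->] : p (x - s (p x)) = 0 by rewrite linearB /= hs subrr.
by exists h.
Qed.

Definition ext_retract x : H := xchoose (ext_retract_ex x).

Lemma ext_retractK x : alpha (ext_retract x) = x - s (p x).
Proof. by apply/esym/eqP; exact: (xchooseP (ext_retract_ex x)). Qed.

Lemma ext_decomp x : x = s (p x) + alpha (ext_retract x).
Proof. by rewrite ext_retractK addrC subrK. Qed.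

Fact ext_retract_is_linear : linear ext_retract.
Proof.
move=> q x y; apply: (@ext_injective _ _ _ _ X).
rewrite [RHS]linearP /= !ext_retractK [p _]linearP [s _]linearP /= scalerBr.
by rewrite opprD addrACA.
Qed.

HB.instance Definition _ :=
  GRing.isLinear.Build {poly C} E H *:%R ext_retract ext_retract_is_linear.

Lemma ext_proj_comb a h : p (s a + alpha h) = a.
Proof. by rewrite linearD /= hs ext_projK addr0. Qed.

Lemma ext_retract_comb a h : ext_retract (s a + alpha h) = h.
Proof.
apply: (@ext_injective _ _ _ _ X).
by rewrite ext_retractK ext_proj_comb addrAC subrr add0r.
Qed.

Lemma ext_retract_inj h : ext_retract (alpha h) = h.
Proof. by have := ext_retract_comb 0 h; rewrite linear0 add0r. Qed.

Lemma ext_retract_section a : ext_retract (s a) = 0.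
Proof. by have := ext_retract_comb a 0; rewrite linear0 addr0. Qed.

End SplitExtension.

Fact addr_rearrange (V : zmodType) (x' x y z t S B : V) :
  x' + (S + B) = x + S + y + (z + t) <-> x' = x + y + z - B + t.
Proof.
have -> : x + S + y + (z + t) = x + y + z - B + t + (S + B).
  rewrite addrA [x + S + y]addrAC [x + y + S + z]addrAC [LHS]addrAC.
  by rewrite [_ - B + t]addrAC addrACA addNr addr0.
by split=> [/addIr|->].
Qed.

Section Intertwine.
Variables (C : fieldType) (H E R : leibnizConformalType C).
Variables (X : extension H E R) (s : {linear R -> E}) (hs : is_section X s).
Variables (c : cocycle_data H R) (hc : is_cocycle_of X s c).
Variables (gamma : lcaAut H) (phi : lcaAut R) (beta : {linear R -> H}).
Variable f : {linear E -> E}.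
Local Notation alpha := (ext_inj X).
Local Notation p := (ext_proj X).
Local Notation c' := (twist gamma phi c).

Hypothesis fH : forall h, f (alpha h) = alpha (gamma h).
Hypothesis fR : forall a, f (s a) = s (phi a) + alpha (beta (phi a)).

Lemma map_f_inj z : polymod_map f (polymod_map alpha z)
  = polymod_map alpha (polymod_map gamma z).
Proof. by apply/malgP => n; rewrite !mcoeff_polymod_map /= fH. Qed.

Lemma map_f_section z : polymod_map f (polymod_map s z)
  = polymod_map s (polymod_map phi z)
    + polymod_map alpha (polymod_map beta (polymod_map phi z)).
Proof. by apply/malgP => n; rewrite mcoeffD !mcoeff_polymod_map /= fR. Qed.

Lemma lbr_inj_section a h :
  lbr (alpha h) (s a) = polymod_map alpha (polymod_flip (coc_r c a h)).
Proof. by have [_ Er _] := hc; rewrite polymod_map_flip Er polymod_flipK. Qed.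

Lemma morphism_l a h :
  polymod_map f (lbr (s a) (alpha h)) = lbr (f (s a)) (f (alpha h)) <->
  coc_l c' (phi a) (gamma h) - coc_l c (phi a) (gamma h)
  = lbr (beta (phi a)) (gamma h).
Proof.
have [El _ _] := hc; rewrite /= !aut_funK fH fR lbrDl -!El -ext_inj_morphism.
rewrite map_f_inj -raddfD /=.
split=> [/(polymod_map_inj (@ext_injective _ _ _ _ X)) ->|<-].
  by rewrite addrAC subrr add0r.
by rewrite addrC subrK.
Qed.

Lemma morphism_r a h :
  polymod_map f (lbr (alpha h) (s a)) = lbr (f (alpha h)) (f (s a)) <->
  coc_r c' (phi a) (gamma h) - coc_r c (phi a) (gamma h)
  = polymod_flip (lbr (gamma h) (beta (phi a))).
Proof.
rewrite /= !aut_funK fH fR lbrDr !lbr_inj_section -ext_inj_morphism.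
rewrite map_f_inj -raddfD polymod_map_flip /=.
split=> [/(polymod_map_inj (@ext_injective _ _ _ _ X)) e|e].
  apply: (can_inj (@polymod_flipK _ _)).
  by rewrite polymod_flipK raddfB /= e addrAC subrr add0r.
congr polymod_map; apply: (can_inj (@polymod_flipK _ _)).
by rewrite raddfD /= !polymod_flipK -e addrC subrK.
Qed.

Lemma morphism_chi a b :
  polymod_map f (lbr (s a) (s b)) = lbr (f (s a)) (f (s b)) <->
  coc_chi c' (phi a) (phi b)
  = coc_chi c (phi a) (phi b) + coc_l c (phi a) (beta (phi b))
    + polymod_flip (coc_r c (phi b) (beta (phi a)))
    - polymod_map beta (lbr (phi a) (phi b))
    + lbr (beta (phi a)) (beta (phi b)).
Proof.
have [El _ Echi] := hc.
have Es u v : lbr (s u) (s v)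
    = polymod_map alpha (coc_chi c u v) + polymod_map s (lbr u v).
  by rewrite Echi subrK.
rewrite /= !aut_funK !fR lbrDl !lbrDr !Es -El lbr_inj_section -ext_inj_morphism.
rewrite raddfD /= map_f_inj map_f_section aut_morphism.
set S := polymod_map s _; set B := polymod_map beta _.
set x' := polymod_map gamma _; set x := coc_chi _ _ _; set y := coc_l _ _ _.
set z := polymod_flip _; set t := lbr (beta _) _.
have eRHS : polymod_map alpha (x + y + z - B + t) = polymod_map alpha x
    + polymod_map alpha y + polymod_map alpha z - polymod_map alpha B
    + polymod_map alpha t by rewrite !raddfD raddfN.
split=> [/addr_rearrange|e].
  by rewrite -eRHS => /(polymod_map_inj (@ext_injective _ _ _ _ X)).
by apply/addr_rearrange; rewrite -eRHS e.
Qed.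

Lemma intertwine_morphism :
  lca_morphism f <->
  [/\ forall (a : R) (h : H),
        coc_l c' a h - coc_l c a h = lbr (beta a) h,
      forall (a : R) (h : H),
        coc_r c' a h - coc_r c a h = polymod_flip (lbr h (beta a))
    & forall a b : R,
        coc_chi c' a b
        = coc_chi c a b + coc_l c a (beta b) + polymod_flip (coc_r c b (beta a))
          - polymod_map beta (lbr a b) + lbr (beta a) (beta b)].
Proof.
split=> [fM|[Hl Hr Hchi] x y].
  split=> [a h|a h|a b].
  - by rewrite -(aut_invK phi a) -(aut_invK gamma h); exact/morphism_l/fM.
  - by rewrite -(aut_invK phi a) -(aut_invK gamma h); exact/morphism_r/fM.
  - by rewrite -(aut_invK phi a) -(aut_invK phi b); exact/morphism_chi/fM.
rewrite (ext_decomp hs x) (ext_decomp hs y) !raddfD /= !lbrDl !lbrDr !raddfD /=.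
move: (p x) (p y) (ext_retract hs x) (ext_retract hs y) => a b h k.
have [_ /(_ (Hl _ _)) ->] := morphism_l a k.
have [_ /(_ (Hr _ _)) ->] := morphism_r b h.
have [_ /(_ (Hchi _ _)) ->] := morphism_chi a b.
by rewrite -(ext_inj_morphism X) map_f_inj aut_morphism ext_inj_morphism !fH.
Qed.

End Intertwine.

Section Lift.
Variables (C : fieldType) (H E R : leibnizConformalType C).
Variables (X : extension H E R) (s : {linear R -> E}) (hs : is_section X s).
Variables (gamma : lcaAut H) (phi : lcaAut R) (beta : {linear R -> H}).
Local Notation alpha := (ext_inj X).
Local Notation p := (ext_proj X).
Local Notation rho := (ext_retract hs).

Definition lift_fun : {linear E -> E} :=
  (s \o phi \o p) \+ (alpha \o ((beta \o phi \o p) \+ (gamma \o rho))).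

Lemma lift_funE x :
  lift_fun x = s (phi (p x)) + alpha (beta (phi (p x)) + gamma (rho x)).
Proof. by []. Qed.

Lemma lift_inj h : lift_fun (alpha h) = alpha (gamma h).
Proof.
by rewrite lift_funE ext_projK ext_retract_inj !linear0 !add0r.
Qed.

Lemma lift_section a : lift_fun (s a) = s (phi a) + alpha (beta (phi a)).
Proof.
by rewrite lift_funE hs ext_retract_section !linear0 addr0.
Qed.

Lemma lift_bij : bijective lift_fun.
Proof.
exists (fun x : E => s (aut_inv phi (p x))
                 + alpha (aut_inv gamma (rho x - beta (p x)))) => x.
  rewrite lift_funE ext_proj_comb // ext_retract_comb aut_funK.
  by rewrite addrAC subrr add0r aut_funK -ext_decomp.
rewrite lift_funE ext_proj_comb // ext_retract_comb !aut_invK.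
by rewrite [beta _ + _]addrC subrK -ext_decomp.
Qed.

End Lift.

Theorem theorem5p2 (RR : realType)
    (R H E : leibnizConformalType (complex RR))
    (X : extension H E R)
    (s : {linear R -> E}) (hs : is_section X s)
    (c : cocycle_data H R) (hc : is_cocycle_of X s c)
    (gamma : lcaAut H) (phi : lcaAut R) :
  inducible X s gamma phi <-> cocycle_equivalent c (twist gamma phi c).
Proof.
split=> [[f [_ fH fR]]|[beta Hbeta]].
  have [beta fS] : exists beta : {linear R -> H},
      forall a, f (s a) = s (phi a) + ext_inj X (beta (phi a)).
    exists (ext_retract hs \o f \o s \o aut_inv phi) => a /=.
    by rewrite aut_funK ext_retractK -fR addrC subrK.
  exists beta.
  exact: (intertwine_morphism hs hc (fun h => esym (fH h)) fS).1
    (@aut_morphism _ _ f).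
have Hlift := intertwine_morphism hs hc (lift_inj hs gamma phi beta)
  (lift_section hs gamma phi beta).
pose f := LcaAut (Hlift.2 Hbeta) (lift_bij hs gamma phi beta).
have fH h : f (ext_inj X h) = ext_inj X (gamma h) by exact: lift_inj.
exists f; split=> [x|h|a]; last 2 first.
- by rewrite fH.
- by rewrite [f _]lift_section ext_proj_comb.
split=> [[h ->]|[h ->]]; first by exists (gamma h); rewrite fH.
by exists (aut_inv gamma h); rewrite fH aut_invK.
Qed.
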